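(* Let $S$ be a Hausdorff semitopological semigroup and let $\Gamma$ be a set of pure $z$-filters on $\mathcal{LMC}(S)$ with the quotient topology. There is an equivalence relation $R$ on $S^{\mathcal{LMC}}$ such that $S^{\mathcal{LMC}}/R$ is Hausdorff, $\Gamma=\{\bigcap[\widetilde{p}]_R:\widetilde{p}\in S^{\mathcal{LMC}}\}$, and $\Gamma$ is homeomorphic to $S^{\mathcal{LMC}}/R$, if and only if both of the following statements hold: (a) Given any topological choice function $f$ for $\Gamma$, there is a finite subfamily $\mathcal{F}$ of $\Gamma$ such that $S^{\mathcal{LMC}}=\bigcup_{\mathcal{L}\in\mathcal{F}}(\overline{f(\mathcal{L})})^\circ$. (b) Given distinct $\mathcal{L}$ and $\mathcal{K}$ in $\Gamma$, there exist $A\in\mathcal{L}^\circ$ and $B\in\mathcal{K}^\circ$ such that for every $\mathcal{C}\in\Gamma$ and all $H,T\in Z(\mathcal{LMC}(S))$, at least one of the following two implications holds: ($S^{\mathcal{LMC}}\setminus(\overline{A})^\circ\subseteq(\overline{H})^\circ$ implies $H\in\mathcal{C}$), or ($S^{\mathcal{LMC}}\setminus(\overline{B})^\circ\subseteq(\overline{T})^\circ$ implies $T\in\mathcal{C}$).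
   Context: **The compactification.** $S$ is a semigroup with a Hausdorff topology in which all maps $\lambda_s(x)=sx$ and $r_s(x)=xs$ are continuous. $\mathcal{CB}(S)$ is the $C^*$-algebra of bounded continuous complex-valued functions on $S$, and $L_sf=f\circ\lambda_s$. For a multiplicative mean (character) $\mu$, put $(\mathbf{T}_\mu f)(s)=\mu(L_sf)$. $\mathcal{LMC}(S)$ is the set of $f\in\mathcal{CB}(S)$ with $\mathbf{T}_\mu f\in\mathcal{CB}(S)$ for every character $\mu$ of $\mathcal{CB}(S)$. It is a $C^*$-subalgebra containing the constants, and it is mapped into itself by $L_s$ and by $\mathbf{T}_\mu$ for every character $\mu$ of $\mathcal{LMC}(S)$. $S^{\mathcal{LMC}}$ is the (compact Hausdorff) space of characters of $\mathcal{LMC}(S)$ with the Gelfand topology and product $\mu\nu=\mu\circ\mathbf{T}_\nu$. $\varepsilon:S\to S^{\mathcal{LMC}}$ is the evaluation map, whose image is dense. **Zero sets and $z$-filters.** $Z(\mathcal{LMC}(S))=\{f^{-1}(0):f\in\mathcal{LMC}(S)\}$. A $z$-filter on $\mathcal{LMC}(S)$ is a family $\mathcal{A}\subseteq Z(\mathcal{LMC}(S))$ with $S\in\mathcal{A}$, $\emptyset\notin\mathcal{A}$, closed under finite intersections and under supersets in $Z(\mathcal{LMC}(S))$. A $z$-ultrafilter is a maximal $z$-filter. For $A\subseteq S$, $\overline{A}$ denotes the closure of $\varepsilon(A)$ in $S^{\mathcal{LMC}}$ (so $\overline{S}=S^{\mathcal{LMC}}$), and for a subset $X$ of $S^{\mathcal{LMC}}$,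 $X^\circ$ is its interior. **Points as $z$-filters.** For every $z$-ultrafilter $p$, $\bigcap_{A\in p}\overline{A}$ is a single point $\mu_p$, and every point of $S^{\mathcal{LMC}}$ is of this form. Let $\widetilde{p}$ be the intersection of all $z$-ultrafilters $q$ with $\mu_q=\mu_p$. The map $\mu_p\mapsto\widetilde{p}$ is a bijection, by which $S^{\mathcal{LMC}}$ is identified with the set of all $z$-filters $\widetilde{p}$. **Pure $z$-filters.** For a $z$-filter $\mathcal{A}$, $\overline{\mathcal{A}}=\{\widetilde{p}: p \text{ a } z\text{-ultrafilter},\ \mathcal{A}\subseteq p\}\subseteq S^{\mathcal{LMC}}$, and $\mathcal{A}^\circ=\{A\in\mathcal{A}:\overline{\mathcal{A}}\subseteq(\overline{A})^\circ\}$. A $z$-filter $\mathcal{A}$ is pure if, for every $z$-ultrafilter $p$, $\mathcal{A}\subseteq p$ implies $\mathcal{A}\subseteq\widetilde{p}$. Pure $z$-filters are taken to correspond exactly to the nonempty closed subsets of $S^{\mathcal{LMC}}$, i.e. a pure $z$-filter $\mathcal{A}$ is assumed to satisfy $\mathcal{A}=\bigcap\overline{\mathcal{A}}$ (the intersection of all the $z$-filters $\widetilde{p}\in\overline{\mathcal{A}}$). **Choice functions, topology, classes.** A topological choice function for $\Gamma$ is a function $f:\Gamma\to\bigcup\Gamma$ such that $\overline{\mathcal{L}}\subseteq(\overline{f(\mathcal{L})})^\circ$ for each $\mathcal{L}\in\Gamma$. For $A\in Z(\mathcal{LMC}(S))$ let $A^*=\{\mathcal{L}\in\Gamma:\overline{\mathcal{L}}\cap\overline{A}\neq\emptyset\}$;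 the quotient topology on $\Gamma$ is the topology generated by the sets $\Gamma\setminus A^*$, $A\in Z(\mathcal{LMC}(S))$. $[\widetilde{p}]_R$ is the $R$-class of $\widetilde{p}$, $\bigcap[\widetilde{p}]_R$ is the intersection of all the $z$-filters belonging to this class, and $S^{\mathcal{LMC}}/R$ carries the usual quotient topology. *)

(* Defs.v *)
From HB Require Import structures.
From mathcomp Require Import all_boot all_order all_algebra.
From mathcomp Require Import generic_quotient complex.
From mathcomp Require Import all_classical all_reals all_analysis.

Set Implicit Arguments.
Unset Strict Implicit.
Unset Printing Implicit Defensive.

Import Order.TTheory GRing.Theory Num.Theory.
Import numFieldNormedType.Exports.

Local Open Scope classical_set_scope.
Local Open Scope ring_scope.
Local Open Scope complex_scope.

HB.mixin Record isSemitopologicalSemigroup S of Topological S & Semigroup S := {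
  lmul_continuous : forall s : S, continuous (fun x : S => (s * x)%g);
  rmul_continuous : forall s : S, continuous (fun x : S => (x * s)%g)
}.

#[short(type="semitopologicalSemigroupType")]
HB.structure Definition SemitopologicalSemigroup :=
  {S of Topological S & Semigroup S & isSemitopologicalSemigroup S}.

Section Functions.
Context (R : realType) (S : semitopologicalSemigroupType).
Local Notation C := (R[i]^o).
Implicit Types (f g : S -> C) (F : set (S -> C)) (mu : (S -> C) -> C).

Definition CB : set (S -> C) :=
  [set f | continuous f /\ exists M : R, forall s, `|f s| <= M%:C].

Definition ltrans (s : S) f : S -> C := fun t => f (s * t)%g.

(* A functional on a function algebra F is a total map on S -> C of which only
   the values on F matter.  A mean is a linear functional mu with
   ||mu|| = mu(1) = 1; the last clause says that ||mu|| <= 1. *)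
Definition multiplicative_mean F mu : Prop :=
  [/\ mu (fun=> 1) = 1,
      forall f g, F f -> F g -> mu (fun s => f s + g s) = mu f + mu g,
      forall (c : C) f, F f -> mu (fun s => c * f s) = c * mu f,
      forall f g, F f -> F g -> mu (fun s => f s * g s) = mu f * mu g &
      forall f (M : R), F f -> (forall s, `|f s| <= M%:C) -> `|mu f| <= M%:C].

Definition Tmean mu f : S -> C := fun s => mu (ltrans s f).

Definition LMC : set (S -> C) :=
  [set f | CB f /\ forall mu, multiplicative_mean CB mu -> CB (Tmean mu f)].

Lemma CB_cst (c : C) : CB (fun=> c).
Proof.
split; first exact: cst_continuous.
by exists (complex.Re `|c|) => s; rewrite RRe_real ?normr_real.
Qed.

Lemma CB_add f g : CB f -> CB g -> CB (fun s => f s + g s).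
Proof.
move=> [cf [M hM]] [cg [N hN]]; split.
  by move=> x; apply: (@cvgD _ C^o); [exact: cf|exact: cg].
exists (M + N) => s; rewrite (le_trans (ler_normD _ _))// rmorphD/=.
exact: lerD.
Qed.

Lemma CB_mul f g : CB f -> CB g -> CB (fun s => f s * g s).
Proof.
move=> [cf [M hM]] [cg [N hN]]; split.
  by move=> x; apply: cvgM; [exact: cf|exact: cg].
by exists (M * N) => s; rewrite normrM rmorphM/= ler_pM.
Qed.

Lemma CB_ltrans s f : CB f -> CB (ltrans s f).
Proof.
move=> [cf [M hM]]; split; last by exists M => t; exact: hM.
by move=> x; apply: continuous_comp; [exact: lmul_continuous|exact: cf].
Qed.

Lemma LMC_cst (c : C) : LMC (fun=> c).
Proof.
split=> [|mu [m1 _ mZ _ _]]; first exact: CB_cst.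
rewrite (_ : Tmean _ _ = (fun=> c)); first exact: CB_cst.
apply/funext => s; rewrite /Tmean /ltrans.
by have := mZ c (fun=> 1) (CB_cst 1); rewrite mulr1 m1 mulr1.
Qed.

Lemma LMC_add f g : LMC f -> LMC g -> LMC (fun s => f s + g s).
Proof.
move=> [Cf Tf] [Cg Tg]; split=> [|mu mmu]; first exact: CB_add.
rewrite (_ : Tmean _ _ = (fun s => Tmean mu f s + Tmean mu g s)).
  by apply: CB_add; [exact: Tf|exact: Tg].
apply/funext => s; case: mmu => _ mD _ _ _.
by rewrite /Tmean -mD//; exact: CB_ltrans.
Qed.

Lemma LMC_mul f g : LMC f -> LMC g -> LMC (fun s => f s * g s).
Proof.
move=> [Cf Tf] [Cg Tg]; split=> [|mu mmu]; first exact: CB_mul.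
rewrite (_ : Tmean _ _ = (fun s => Tmean mu f s * Tmean mu g s)).
  by apply: CB_mul; [exact: Tf|exact: Tg].
apply/funext => s; case: mmu => _ _ _ mM _.
by rewrite /Tmean -mM//; exact: CB_ltrans.
Qed.

(* The values outside LMC are set to 0, so that distinct points are distinct
   functionals on LMC.  The topology is the one induced by pointwise
   convergence, i.e. the Gelfand topology. *)
Definition spectrum : set {ptws (S -> C) -> C} :=
  [set mu | multiplicative_mean LMC mu /\ forall f, ~ LMC f -> mu f = 0].

Definition SLMC : Type := set_type spectrum.
HB.instance Definition _ := Topological.on SLMC.

Definition evalLMC (s : S) : {ptws (S -> C) -> C} :=
  fun f => if f \in LMC then f s else 0.

Lemma evalLMCE s f : LMC f -> evalLMC s f = f s.
Proof. by move=> Lf; rewrite /evalLMC mem_set. Qed.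

Lemma evalLMC_spectrum s : evalLMC s \in spectrum.
Proof.
apply/mem_set; split; last by move=> f nLf; rewrite /evalLMC memNset.
split=> [|f g Lf Lg|c f Lf|f g Lf Lg|f M Lf fM].
- by rewrite evalLMCE//; exact: LMC_cst.
- by rewrite !evalLMCE//; exact: LMC_add.
- by rewrite !evalLMCE//; apply: LMC_mul => //; exact: LMC_cst.
- by rewrite !evalLMCE//; exact: LMC_mul.
- by rewrite evalLMCE.
Qed.

Definition eps (s : S) : SLMC := SigSub (evalLMC_spectrum s).

End Functions.

Section ZFilters.
Context (R : realType) (S : semitopologicalSemigroupType).
Local Notation X := (SLMC R S).
Implicit Types (A B : set S) (F p q : set (set S)) (Gamma : set (set (set S))).

Definition Zsets : set (set S) := [set f @^-1` [set 0] | f in @LMC R S].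

Definition z_filter F : Prop :=
  [/\ F `<=` Zsets, F setT, ~ F set0,
      forall A B, F A -> F B -> F (A `&` B) &
      forall A B, F A -> Zsets B -> A `<=` B -> F B].

Definition z_ultrafilter p : Prop :=
  z_filter p /\ forall q, z_filter q -> p `<=` q -> q = p.

Definition cl A : set X := closure (@eps R S @` A).

(* For a z-ultrafilter p this is the singleton of the point mu_p. *)
Definition zlim p : set X := \bigcap_(A in p) cl A.

Definition ztilde p : set (set S) :=
  \bigcap_(q in [set q | z_ultrafilter q /\ zlim q = zlim p]) q.

(* The z-filter identified with the point mu. *)
Definition zpoint (mu : X) : set (set S) :=
  \bigcap_(q in [set q | z_ultrafilter q /\ zlim q = [set mu]]) q.

Lemma zpointE p mu : zlim p = [set mu] -> zpoint mu = ztilde p.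
Proof. by rewrite /ztilde => ->. Qed.

Definition zbar F : set X :=
  [set mu | exists p, [/\ z_ultrafilter p, F `<=` p & zlim p = [set mu]]].

Definition zint F : set (set S) := [set A | F A /\ zbar F `<=` (cl A)°].

Definition pure_z_filter F : Prop :=
  [/\ z_filter F,
      forall p, z_ultrafilter p -> F `<=` p -> F `<=` ztilde p &
      F = \bigcap_(mu in zbar F) zpoint mu].

(* Only the values of f on Gamma matter. *)
Definition topological_choice Gamma (f : set (set S) -> set S) : Prop :=
  forall L, Gamma L ->
    (\bigcup_(K in Gamma) K) (f L) /\ zbar L `<=` (cl (f L))°.

Definition zstar Gamma A : set (set_type Gamma) :=
  [set L | zbar (set_val L) `&` cl A !=set0].

End ZFilters.

Arguments cl R {S} A.
Arguments zlim R {S} p.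
Arguments zbar R {S} F.

(* R is a phantom argument of the type, but the topology depends on it. *)
Definition Gamma_space (R : realType) (S : semitopologicalSemigroupType)
  (Gamma : set (set (set S))) : Type := set_type Gamma.

Section GammaSpace.
Context (R : realType) (S : semitopologicalSemigroupType).
Context (Gamma : set (set (set S))).

HB.instance Definition _ := Choice.on (Gamma_space R Gamma).
HB.instance Definition _ :=
  isSubBaseTopological.Build (Gamma_space R Gamma) (Zsets R (S := S))
    (fun A => ~` zstar R (Gamma := Gamma) A).

End GammaSpace.

Definition homeomorphic (X Y : topologicalType) : Prop :=
  exists (f : X -> Y) (g : Y -> X),
    [/\ continuous f, continuous g, cancel f g & cancel g f].

(* Main.v *)
(* Write X for S^LMC.  A multiplicative mean on a conjugation-closed algebra is
   approximated by evaluations on every finite family of functions, so it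
   commutes with Lipschitz maps; hence LMC(S) is closed under composition with
   Lipschitz maps, eps(S) is dense in X, and every closed subset of X has
   arbitrarily small neighbourhoods of the form cl A with A a zero set.  The
   sets zbar L are therefore closed, and (b) says that L and K have
   neighbourhoods (cl A)° and (cl B)° such that no zbar C meets both.
   If Gamma comes from an equivalence relation with Hausdorff quotient, the
   sets zbar L are its classes: (a) is compactness of X, and (b) is separation
   in the quotient.  Conversely, (b) makes the zbar L pairwise disjoint, and by
   (a) they cover X, for a point outside their union could be avoided by a
   topological choice function.  Combining (a) and (b), this decomposition is
   upper semicontinuous, which yields that the quotient is Hausdorff and
   homeomorphic to Gamma. *)
Require Import Defs.
From HB Require Import structures.
From mathcomp Require Import all_boot all_order all_algebra.
From mathcomp Require Import finmap generic_quotient complex.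
From mathcomp Require Import all_classical all_reals all_analysis.

Set Implicit Arguments.
Unset Strict Implicit.
Unset Printing Implicit Defensive.

Local Open Scope classical_set_scope.

Import Order.TTheory GRing.Theory Num.Theory.
Import numFieldNormedType.Exports.

(** * Approximation of means by point evaluations *)

Section Means.
Local Open Scope ring_scope.
Local Open Scope complex_scope.
Context (R : realType) (S : semitopologicalSemigroupType).
Local Notation C := (R[i]^o).
Implicit Types (f g : S -> C) (F : set (S -> C)) (mu : (S -> C) -> C).

(** Isolates what the approximation argument uses. It is applied first to [CB], which yields closure
    of [LMC] under conjugation, and then to [LMC] itself. *)
Definition conj_closed_algebra F : Prop :=
  [/\ forall c : C, F (fun=> c),
      forall f g, F f -> F g -> F (fun s => f s + g s),
      forall f g, F f -> F g -> F (fun s => f s * g s),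
      forall f, F f -> F (fun s => (f s)^*) &
      forall f, F f -> exists M : R, forall s, `|f s| <= M%:C].

Lemma mean_cst F mu (c : C) :
  F (fun=> 1) -> multiplicative_mean F mu -> mu (fun=> c) = c.
Proof.
move=> F1 [m1 _ mZ _ _]; have := mZ c _ F1.
rewrite m1 mulr1; apply: etrans.
by congr mu; apply/funext => s; rewrite mulr1.
Qed.

(* The sum of the |f - mu f|^2 is annihilated by mu, so it cannot be bounded
   away from 0: a mean vanishes on no function bounded below by a positive
   constant since it has norm 1. *)
Lemma mean_approx F mu (fs : seq (S -> C)) (d : C) :
  conj_closed_algebra F -> multiplicative_mean F mu -> 0 < d ->
  (forall f, f \in fs -> F f) ->
  exists s, forall f, f \in fs -> `|f s - mu f| < d.
Proof.
move=> [Fc FD FM FJ Fb] mmu d0 Ffs.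
have [m1 mD mZ mM mb] := mmu.
have [g [Fg mg g0]] : exists g, [/\ F g, mu g = 0 & forall s, 0 <= g s /\
    forall f, f \in fs -> `|f s - mu f| ^+ 2 <= g s].
  elim: fs Ffs => [_|f fs IH Ffs].
    exists (fun=> 0); split => //; first by rewrite (mean_cst _ (Fc 1)).
  have [|g [Fg mg g0]] := IH; first by move=> h hfs; apply: Ffs; rewrite inE hfs orbT.
  have Ff : F f by apply: Ffs; rewrite inE eqxx.
  pose h s := f s + - mu f; have Fh : F h by apply: FD.
  pose k s := h s * (h s)^*; have Fk : F k by apply: FM => //; exact: FJ.
  exists (fun s => k s + g s); split; first exact: FD.
  - rewrite mD// mg addr0 mM//; last exact: FJ.
    by rewrite /h mD// (mean_cst _ (Fc 1))// subrr mul0r.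
  - move=> s; have [gs0 gs] := g0 s; have ks : k s = `|f s - mu f| ^+ 2.
      by rewrite sqr_normc.
    rewrite ks; split; first by rewrite addr_ge0// exprn_ge0.
    move=> h' ; rewrite inE => /predU1P[->|h'fs]; first by rewrite lerDl.
    by rewrite (le_trans (gs _ h'fs))// lerDr exprn_ge0.
apply: contrapT => /forallNP nex.
have gd s : d ^+ 2 <= g s.
  have /existsNP[f /not_implyP[ffs /negP nf]] := nex s.
  have [_ /(_ _ ffs)] := g0 s; apply: le_trans.
  rewrite ler_pXn2r ?nnegrE//; last exact: ltW.
  by rewrite real_leNgt ?normr_real// gtr0_real.
have [M hM] := Fb _ Fg.
(* Since d^2 <= g <= M, the function M - g has sup norm at most M - d^2, yet its mean is M. *)
have MC : F (fun s => M%:C + (-1) * g s) by apply: FD => //; exact: FM.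
have mMg : mu (fun s => M%:C + (-1) * g s) = M%:C.
  rewrite mD//; last exact: FM.
  by rewrite mZ// mg mulr0 addr0 (mean_cst _ (Fc 1)).
have dR : (complex.Re d)%:C = d by rewrite RRe_real// gtr0_real.
have := mb _ (M - complex.Re d ^+ 2) MC; rewrite mMg => H.
have {}H : `|M%:C| <= M%:C - d ^+ 2 :> C.
  rewrite -dR -rmorphXn/= -rmorphB/=; apply: H => s; rewrite mulN1r.
  have := hM s; have [gs0 _] := g0 s; rewrite ger0_norm// => gM.
  by rewrite ger0_norm ?subr_ge0// rmorphB/= rmorphXn/= dR lerB.
have : M%:C <= M%:C - d ^+ 2 :> C.
  by apply: le_trans H; rewrite real_ler_norm// -(@RRe_real _ M%:C)//= complex_real.
by rewrite lerBrDr gerDl => /le_lt_trans /(_ (exprn_gt0 2 d0)); rewrite ltxx.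
Qed.

End Means.

(** * Stability of [CB] and [LMC] under Lipschitz maps *)

Section Lipschitz.
Local Open Scope ring_scope.
Local Open Scope complex_scope.
Context (R : realType) (S : semitopologicalSemigroupType).
Local Notation C := (R[i]^o).
Implicit Types (f g : S -> C) (F : set (S -> C)) (mu : (S -> C) -> C).
Implicit Types (phi : C -> C) (K : C).

(** Let d be the distance between the two sides. At a point where [f] and its composite with [phi]
    are both within d / (K + 1) of their means, the triangle inequality gives d < d / (K + 1) + K d
    / (K + 1) = d. *)
Lemma mean_lipschitz F mu phi K f :
  conj_closed_algebra F -> multiplicative_mean F mu -> 0 < K ->
  (forall z w, `|phi z - phi w| <= K * `|z - w|) ->
  F f -> F (fun s => phi (f s)) -> mu (fun s => phi (f s)) = phi (mu f).
Proof.
move=> hF mmu K0 phiK Ff Fphi; apply/eqP; rewrite -subr_eq0 -normr_le0.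
apply/negP => /negP; set d := `|_ - _|; have dR : d \is Num.real by exact: normr_real.
rewrite -real_ltNge// => d0; have K1 : 0 < K + 1 by exact: addr_gt0.
have [||s hs] := @mean_approx _ _ _ _ [:: f; fun s => phi (f s)]
  (d / (K + 1)) hF mmu; first by rewrite divr_gt0.
  by move=> g; rewrite !inE => /orP[]/eqP ->.
have h1 := hs f; rewrite inE eqxx in h1; have {}h1 := h1 isT.
have h2 := hs (fun s => phi (f s)).
rewrite !inE eqxx orbT in h2; have {}h2 := h2 isT.
have {}h1 : `|phi (f s) - phi (mu f)| < K * (d / (K + 1)).
  by rewrite (le_lt_trans (phiK _ _))// ltr_pM2l.
have : d < d / (K + 1) + K * (d / (K + 1)).
  rewrite {1}/d -[X in `|X|](subrKA (phi (f s))).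
  by rewrite (le_lt_trans (ler_normD _ _))// distrC ltrD.
suff -> : d / (K + 1) + K * (d / (K + 1)) = d by rewrite ltxx.
by rewrite -{1}[d / _]mul1r -mulrDl [1 + K]addrC mulrCA divff ?mulr1// gt_eqF.
Qed.

Lemma CB_conj_closed_algebra : conj_closed_algebra (@CB R S).
Proof.
split; [exact: CB_cst|exact: CB_add|exact: CB_mul| |by move=> f []].
move=> f [cf [M hM]]; split; last by exists M => s; rewrite normcJ.
move=> x; apply/cvgrPdist_lt => e e0; move/cvgrPdist_lt : (cf x) => /(_ e e0).
by apply: filterS => t; rewrite -rmorphB/= normcJ.
Qed.

Lemma CB_lipschitz phi K f : 0 < K ->
  (forall z w, `|phi z - phi w| <= K * `|z - w|) ->
  CB f -> CB (fun s => phi (f s)).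
Proof.
move=> K0 phiK [cf [M hM]]; split.
  move=> x; apply/cvgrPdist_lt => e e0; move/cvgrPdist_lt : (cf x) => /(_ (e / K)).
  rewrite divr_gt0// => /(_ isT); apply: filterS => t.
  by rewrite ltr_pdivlMr// mulrC; apply: le_lt_trans.
have RR (z : C) : z \is Num.real -> (complex.Re z)%:C = z by exact: RRe_real.
exists (complex.Re K * M + complex.Re `|phi 0|) => s.
rewrite rmorphD rmorphM/= !RR ?normr_real ?gtr0_real//.
rewrite -[phi (f s)](subrK (phi 0)) (le_trans (ler_normD _ _))// lerD2r.
by rewrite (le_trans (phiK _ _))// subr0 ler_pM2l.
Qed.

(** [Tmean mu] commutes with [phi], by [mean_lipschitz] on [CB] applied to each left translate of
    [f]. *)
Lemma LMC_lipschitz phi K f : 0 < K ->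
  (forall z w, `|phi z - phi w| <= K * `|z - w|) ->
  LMC f -> LMC (fun s => phi (f s)).
Proof.
move=> K0 phiK [Cf Tf]; split=> [|mu mmu]; first exact: (CB_lipschitz K0).
rewrite (_ : Tmean _ _ = (fun s => phi (Tmean mu f s))).
  by apply: (CB_lipschitz K0) => //; exact: Tf.
apply/funext => s; rewrite /Tmean.
apply: (mean_lipschitz (f := ltrans s f) CB_conj_closed_algebra mmu K0 phiK).
  exact: CB_ltrans.
by apply: (CB_lipschitz K0) => //; exact: CB_ltrans.
Qed.

Lemma LMC_conj_closed_algebra : conj_closed_algebra (@LMC R S).
Proof.
split; [exact: LMC_cst|exact: LMC_add|exact: LMC_mul| |by move=> f [[]]].
move=> f; apply: (@LMC_lipschitz (@conjc R) 1) => // z w.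
by rewrite -rmorphB/= normcJ mul1r.
Qed.

(* Vanishes exactly on the disc of center c and radius r. *)
Definition disc_defect (c r : C) : C -> C :=
  fun z => `| `|z - c| - r| + (`|z - c| - r).

Lemma disc_defect_eq0 c r z : (disc_defect c r z == 0) = (`|z - c| <= r).
Proof.
by rewrite /disc_defect addr_eq0 -ler0_def subr_le0.
Qed.

Lemma disc_defect_lipschitz c r z w :
  `|disc_defect c r z - disc_defect c r w| <= 2 * `|z - w|.
Proof.
rewrite /disc_defect opprD addrACA (le_trans (ler_normD _ _))//.
have h : `| `|z - c| - r - (`|w - c| - r)| <= `|z - w|.
  rewrite opprB addrA subrK (le_trans (ler_dist_dist _ _))//.
  by rewrite opprB addrA subrK.
rewrite mulrDl mul1r lerD// (le_trans (ler_dist_dist _ _))//.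
Qed.

End Lipschitz.

(** * Pointwise convergence and finite subcovers *)

Section Topology.

Lemma cvg_ptws (I : Type) (V : topologicalType) (F : set_system (I -> V))
    (f : I -> V) : Filter F ->
  (forall i, g i @[g --> F] --> f i) -> {ptws, F --> f}.
Proof.
move=> FF cvF; apply/cvg_sup => i; apply/cvg_image.
  by rewrite eqEsubset; split=> v // _; exists (cst v).
apply: cvg_trans (cvF i) => W /= FW; exists (@^~ i @^-1` W) => //.
by rewrite eqEsubset; split => [j [? + <-//]|j Wj]; exists (fun=> j).
Qed.

Lemma ptws_eval_continuous (I : Type) (V : topologicalType) (i : I) :
  continuous (fun g : {ptws I -> V} => g i).
Proof. exact: (@proj_continuous {classic I} (fun=> V) i). Qed.

(** Otherwise the parts of [A] left uncovered by finite subfamilies generate a proper filter. A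
    cluster point of it lies in some [f i], although the complement of [f i] belongs to the
    filter. *)
Lemma compact_finite_cover (T : topologicalType) (A : set T) (I : Type)
    (D : set I) (f : I -> set T) :
  compact A -> (forall i, D i -> open (f i)) -> A `<=` \bigcup_(i in D) f i ->
  exists D', [/\ finite_set D', D' `<=` D & A `<=` \bigcup_(i in D') f i].
Proof.
move=> cA fo Af; apply: contrapT => nD.
pose fin (E : set I) := finite_set E /\ E `<=` D.
pose G : set_system T := filter_from fin (fun E => A `\` \bigcup_(i in E) f i).
have GF : ProperFilter G.
  apply: filter_from_proper.
    apply: filter_from_filter; first by exists set0; split.
    move=> E1 E2 [f1 s1] [f2 s2]; exists (E1 `|` E2).
      by split; [rewrite finite_setU|rewrite subUset].
    by rewrite bigcup_setU setDUr.
  move=> E [fE sE]; apply/set0P/eqP => E0; apply: nD; exists E; split => //.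
  by rewrite -setD_eq0.
have [|x [Ax cx]] := cA G GF; first by exists set0; [split|rewrite bigcup_set0 setD0].
have [i Di fx] := Af x Ax.
have Gi : G (A `\` f i).
  exists [set i]; last by rewrite bigcup_set1.
  by split => // j ->.
have [|y [[_ nfy] fy]] := cx _ (f i) Gi; last exact: nfy.
by apply: open_nbhs_nbhs; split => //; exact: fo.
Qed.

End Topology.

(** * Closed discs and bounded sets in the complex plane *)

Section ComplexTopology.
Local Open Scope ring_scope.
Local Open Scope complex_scope.
Context (R : realType).
Local Notation C := (R[i]^o).

Lemma lipschitz_continuous (V : normedModType R[i]) (h : V -> C) (K : C) : 0 < K ->
  (forall z w, `|h z - h w| <= K * `|z - w|) -> continuous h.
Proof.
move=> K0 hK x; apply/cvgrPdist_lt => e e0.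
have : \forall t \near x, `|x - t| < e / K.
  by apply: (@cvgr_dist_lt _ _ _ (nbhs x) _ id) => //; rewrite divr_gt0.
by apply: filterS => t; rewrite ltr_pdivlMr// mulrC; apply: le_lt_trans.
Qed.

Lemma closed_eqfun (T : topologicalType) (h k : T -> C) :
  continuous h -> continuous k -> closed [set x | h x = k x].
Proof.
move=> ch ck; rewrite (_ : mkset _ = (fun x => h x - k x) @^-1` [set 0]).
  apply: closed_comp => [x _|]; first by apply: (@cvgB _ C); [exact: ch|exact: ck].
  exact/accessible_closed_set1/hausdorff_accessible/norm_hausdorff.
by apply/seteqP; split => x /=; [move=> ->; rewrite subrr|move/subr0_eq].
Qed.

(** The condition is rewritten as the vanishing of the continuous function [disc_defect]. *)
Lemma closed_disc (T : topologicalType) (h : T -> C) (c r : C) :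
  continuous h -> closed [set x | `|h x - c| <= r].
Proof.
move=> ch; rewrite (_ : mkset _ = [set x | disc_defect c r (h x) = 0]).
  apply: closed_eqfun; last exact: cst_continuous.
  move=> x; apply: continuous_comp; first exact: ch.
  by apply: (@lipschitz_continuous C _ 2) => // z w; exact: disc_defect_lipschitz.
by apply/seteqP; split => x /=; rewrite -disc_defect_eq0 => /eqP.
Qed.

(** The disc lies in the square of half-side [M], a continuous image of a product of two
    segments. *)
Lemma complex_bounded_compact (M : R) :
  exists K : set C, compact K /\ forall z : C, `|z| <= M%:C -> K z.
Proof.
pose h (p : R * R) : C := p.1 +i* p.2.
exists (h @` (`[- M, M] `*` `[- M, M])%classic); split.
  apply: continuous_compact; last by apply: compact_setX; exact: segment_compact.
  apply: continuous_subspaceT => x; apply/cvgrPdist_lt => e e0.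
  have eR : (complex.Re e)%:C = e by rewrite RRe_real// gtr0_real.
  have e20 : 0 < complex.Re e / 2 by rewrite divr_gt0// -ltcR eR.
  have h1 : \forall t \near x, `|x.1 - t.1| < complex.Re e / 2.
    have : fst @ nbhs x --> x.1 by exact: cvg_fst.
    by move/cvgrPdist_lt => /(_ _ e20).
  have h2 : \forall t \near x, `|x.2 - t.2| < complex.Re e / 2.
    have : snd @ nbhs x --> x.2 by exact: cvg_snd.
    by move/cvgrPdist_lt => /(_ _ e20).
  apply: filterS2 h1 h2 => t t1 t2.
  have -> : h x - h t = (x.1 - t.1)%:C + 'i * (x.2 - t.2)%:C.
    by rewrite /h; simpc.
  rewrite -eR [complex.Re e]splitr [in X in _ < X]rmorphD/=.
  rewrite (le_lt_trans (ler_normD _ _))//.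
  have nC (a : R) : `|a%:C| = `|a|%:C by rewrite normc_def/= expr0n/= addr0 sqrtr_sqr.
  have n1 : `|'i : R[i]| = 1.
    by rewrite normc_def/= expr0n/= expr1n add0r sqrtr1.
  by rewrite normrM n1 mul1r !nC ltrD// ltcR.
case=> a b abM; exists (a, b) => //; split => /=; rewrite in_itv/= -ler_norml -lecR.
  by apply: le_trans abM; exact: (normc_ge_Re (a +i* b)).
apply: le_trans abM; rewrite normc_def/= lecR -sqrtr_sqr ler_sqrt ?addr_ge0 ?sqr_ge0//.
by rewrite lerDr sqr_ge0.
Qed.

End ComplexTopology.

(** * The character space is compact and Hausdorff, with dense evaluations *)

Section Spectrum.
Local Open Scope ring_scope.
Local Open Scope complex_scope.
Context (R : realType) (S : semitopologicalSemigroupType).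
Local Notation C := (R[i]^o).
Local Notation X := (SLMC R S).
Implicit Types (f g : S -> C) (mu nu : X).

(** The Gelfand transform of [f]. *)
Definition gelfand f mu : C := (set_val (mu : set_type (@spectrum R S))) f.

Lemma gelfand_mean mu : multiplicative_mean (@LMC R S) (gelfand ^~ mu).
Proof. by have [] := set_mem (valP mu). Qed.

Lemma gelfand_out f mu : ~ LMC f -> gelfand f mu = 0.
Proof. by have [_] := set_mem (valP mu); exact. Qed.

Lemma gelfand_eps f s : LMC f -> gelfand f (eps R s) = f s.
Proof. by move=> Lf; rewrite /gelfand [LHS]evalLMCE. Qed.

Lemma gelfand_inj mu nu : (forall f, LMC f -> gelfand f mu = gelfand f nu) -> mu = nu.
Proof.
move=> h; apply/val_inj/funext => f; have [/h//|nf] := pselect (LMC f).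
have := gelfand_out mu nf; have := gelfand_out nu nf.
by rewrite /gelfand !set_valE => -> ->.
Qed.

Lemma gelfand_continuous f : continuous (gelfand f).
Proof.
move=> mu; have c1 : {for mu, continuous (set_val : X -> {ptws (S -> C) -> C})}.
  exact: initial_continuous.
exact: continuous_comp c1 (@ptws_eval_continuous _ _ f _).
Qed.

Lemma SLMC_hausdorff : hausdorff_space X.
Proof.
move=> mu nu clmn; apply: gelfand_inj => f _.
apply: (@norm_hausdorff _ C) => A B nA nB.
have [||x [Ax Bx]] := clmn (gelfand f @^-1` A) (gelfand f @^-1` B).
- exact: gelfand_continuous.
- exact: gelfand_continuous.
- by exists (gelfand f x).
Qed.

Definition gelfand_near mu (fs : seq (S -> C)) (d : C) : set X :=
  [set nu | forall f, f \in fs -> `|gelfand f nu - gelfand f mu| < d].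

Lemma gelfand_near_nbhs mu fs d : 0 < d -> nbhs mu (gelfand_near mu fs d).
Proof.
move=> d0; elim: fs => [|f fs IH].
  by apply: (@filterS _ (nbhs mu) _ setT) filterT => nu _ f; rewrite in_nil.
have : \forall nu \near mu, `|gelfand f nu - gelfand f mu| < d.
  have /cvgrPdist_lt/(_ _ d0) := @gelfand_continuous f mu.
  by apply: filterS => nu; rewrite distrC.
apply: (@filterS2 _ (nbhs mu)) IH => nu h1 h2 g.
by rewrite inE => /predU1P[->//|]; exact: h1.
Qed.

(** The filter generated by the sets [gelfand_near mu fs d] converges to [mu] at every function: on
    [LMC] by construction, elsewhere because all transforms vanish there. Hence it refines the
    neighbourhood filter of [mu]. *)
Lemma gelfand_near_basis mu (O : set X) : nbhs mu O ->
  exists fs d, [/\ 0 < d, forall f, f \in fs -> LMC f & gelfand_near mu fs d `<=` O].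
Proof.
pose good (p : seq (S -> C) * C) := 0 < p.2 /\ forall f, f \in p.1 -> LMC f.
pose G : set_system X := filter_from good (fun p => gelfand_near mu p.1 p.2).
have FG : Filter G.
  apply: filter_from_filter; first by exists ([::], 1); split.
  move=> [fs d] [gs e] [/= d0 Lfs] [/= e0 Lgs].
  have dR : d \is Num.real by exact: gtr0_real.
  have eR : e \is Num.real by exact: gtr0_real.
  exists (fs ++ gs, Num.min d e).
    split => /=; first by rewrite minElt; case: ifP.
    by move=> f; rewrite mem_cat => /orP[/Lfs|/Lgs].
  move=> nu /= h; split => f hf; have := h f; rewrite mem_cat hf ?orbT => /(_ isT);
  by rewrite comparable_lt_min ?real_comparable// => /andP[].
suff GT : G --> mu by move/GT => -[[fs d] [/= d0 Lfs] sO]; exists fs, d.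
have GP : {ptws, (set_val : X -> (S -> C) -> C) @ G --> set_val mu}.
  apply: cvg_ptws => f; have [Lf|nLf] := pselect (LMC f).
    apply/cvgrPdist_lt => e e0; exists ([:: f], e).
      by split => // g; rewrite inE => /eqP ->.
    by move=> nu /(_ f); rewrite inE eqxx distrC; exact.
  have h nu : (set_val nu : (S -> C) -> C) f = 0 by exact: gelfand_out nLf.
  rewrite h; apply/cvgrPdist_lt => e e0; exists ([::], 1) => //.
  by move=> nu _ /=; rewrite h subrr normr0.
move=> O' [B [[W oW <-] /= Wmu] sB].
by apply: (filterS sB); apply: GP; exact: open_nbhs_nbhs.
Qed.

Lemma eps_dense : closure (range (@eps R S)) = setT.
Proof.
apply/seteqP; split => // mu _ O /gelfand_near_basis[fs [d [d0 Lfs sO]]].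
have [s hs] := mean_approx (LMC_conj_closed_algebra R S) (gelfand_mean mu) d0 Lfs.
exists (eps R s); split; first by exists s.
by apply: sO => f ffs; rewrite gelfand_eps ?hs//; exact: Lfs.
Qed.

Lemma spectrum_closed : closed (@spectrum R S).
Proof.
have ev f : continuous (fun mu : {ptws (S -> C) -> C} => mu f).
  exact: ptws_eval_continuous.
(* Each defining condition of the spectrum is closed for pointwise convergence, so it passes to the
   closure. *)
have clos (D : set {ptws (S -> C) -> C}) (mu : {ptws (S -> C) -> C}) :
    closed D -> @spectrum R S `<=` D ->
    closure (@spectrum R S) mu -> D mu.
  by move=> cD sD; rewrite closureE; apply.
move=> mu cmu; split; first split.
- apply: (clos [set nu | nu (fun=> 1) = 1]) cmu; last by move=> nu [[]].
  by apply: closed_eqfun; [exact: ev|exact: cst_continuous].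
- move=> f g Lf Lg.
  apply: (clos [set nu | nu (fun s => f s + g s) = nu f + nu g]) cmu.
    apply: closed_eqfun; first exact: ev.
    by move=> x; exact: (cvgD (ev f x) (ev g x)).
  by move=> nu [[_ h _ _ _]] _; exact: h.
- move=> c f Lf.
  apply: (clos [set nu | nu (fun s => c * f s) = c * nu f]) cmu.
    apply: closed_eqfun; first exact: ev.
    by move=> x; exact: (cvgM (cvg_cst c) (ev f x)).
  by move=> nu [[_ _ h _ _]] _; exact: h.
- move=> f g Lf Lg.
  apply: (clos [set nu | nu (fun s => f s * g s) = nu f * nu g]) cmu.
    apply: closed_eqfun; first exact: ev.
    by move=> x; exact: (cvgM (ev f x) (ev g x)).
  by move=> nu [[_ _ _ h _]] _; exact: h.
- move=> f M Lf fM; rewrite -[mu f]subr0.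
  apply: (clos [set nu | `|nu f - 0| <= M%:C]) cmu; first exact: closed_disc.
  by move=> nu [[_ _ _ _ h]] _ /=; rewrite subr0; exact: h.
- move=> f nLf; apply: (clos [set nu | nu f = 0]) cmu.
    by apply: closed_eqfun; [exact: ev|exact: cst_continuous].
  by move=> nu [_]; exact.
Qed.

(** Tychonoff: the value at a bounded [f] in [LMC] stays in a fixed compact set, the value at any
    other [f] is 0, and the spectrum is closed in the product. *)
Lemma spectrum_compact : compact (@spectrum R S).
Proof.
have hK f : exists K : set C, compact K /\
    forall m : {ptws (S -> C) -> C}, @spectrum R S m -> K (m f).
  have [Lf|nLf] := pselect (LMC f).
    have [_ [M fM]] := Lf.1; have [K [cK hK]] := complex_bounded_compact M.
    by exists K; split => // mu [[_ _ _ _ h] _]; apply: hK; exact: h.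
  exists [set 0]; split; first exact: compact_set1.
  by move=> mu [_]; exact.
have [K hKf] := choice hK.
have cK := @tychonoff {classic (S -> C)} (fun=> C) K (fun f => (hKf f).1).
apply: subclosed_compact cK _; first exact: spectrum_closed.
by move=> mu smu f; exact: (hKf f).2.
Qed.

Lemma SLMC_compact : compact [set: X].
Proof.
move=> F PF _.
have [|mu [smu cmu]] := spectrum_compact (F := (set_val : X -> _) @ F).
  by apply: (@filterS _ F _ setT) filterT => nu _; exact: set_mem (valP nu).
exists (SigSub (mem_set smu)); split => // A B FA [_ [[W oW <-] /= Wmu] sB].
have [||_ [[nu Anu <-] Wnu]] := cmu (set_val @` A) W.
- by apply: (@filterS _ F) FA => nu Anu; exists nu.
- exact: open_nbhs_nbhs.
- by exists nu; split => //; exact: sB.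
Qed.

End Spectrum.

(** * Zero sets and the neighbourhoods given by their closures *)

Section ZeroSets.
Local Open Scope ring_scope.
Local Open Scope complex_scope.
Context (R : realType) (S : semitopologicalSemigroupType).
Local Notation C := (R[i]^o).
Local Notation X := (SLMC R S).
Local Notation Zsets := (@Zsets R S).
Implicit Types (A B : set S) (mu nu : X).

Lemma Zsets_disc (f : S -> C) (c r : C) : LMC f ->
  Zsets [set s | `|f s - c| <= r].
Proof.
move=> Lf; exists (fun s => disc_defect c r (f s)).
  by apply: (@LMC_lipschitz _ _ _ 2) => // z w; exact: disc_defect_lipschitz.
by apply/seteqP; split => s /=; rewrite -disc_defect_eq0 => /eqP.
Qed.

Lemma ZsetsT : Zsets setT.
Proof. by exists (fun=> 0); [exact: LMC_cst|apply/seteqP; split]. Qed.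

Lemma Zsets0 : Zsets set0.
Proof.
exists (fun=> 1); [exact: LMC_cst|apply/seteqP; split => // s /= /eqP].
by rewrite oner_eq0.
Qed.

Lemma ZsetsI A B : Zsets A -> Zsets B -> Zsets (A `&` B).
Proof.
have [_ _ _ LJ _] := LMC_conj_closed_algebra R S.
move=> [f Lf <-] [g Lg <-].
(* |f|^2 + |g|^2 vanishes exactly where both functions do. *)
exists (fun s => f s * (f s)^* + g s * (g s)^*).
  by apply: LMC_add; apply: LMC_mul => //; exact: LJ.
apply/seteqP; split => s /=; last by move=> [-> ->]; rewrite !mul0r addr0.
rewrite -!sqr_normc => /eqP; rewrite paddr_eq0 ?exprn_ge0// !sqrf_eq0 !normr_eq0.
by move=> /andP[/eqP -> /eqP ->].
Qed.

Lemma ZsetsU A B : Zsets A -> Zsets B -> Zsets (A `|` B).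
Proof.
move=> [f Lf <-] [g Lg <-]; exists (fun s => f s * g s); first exact: LMC_mul.
apply/seteqP; split => s /=; last by move=> [->|->]; rewrite ?mul0r ?mulr0.
by move=> /eqP; rewrite mulf_eq0 => /orP[/eqP ->|/eqP ->]; [left|right].
Qed.

Lemma Zsets_bigcup (I : choiceType) (D : set I) (f : I -> set S) :
  finite_set D -> (forall i, D i -> Zsets (f i)) -> Zsets (\bigcup_(i in D) f i).
Proof.
move=> /finite_seqP[s ->] fZ; rewrite bigcup_seq big_seq.
by elim/big_ind : _ => //; [exact: Zsets0|exact: ZsetsU].
Qed.

Lemma cl_closed A : closed (cl R A).
Proof. exact: closed_closure. Qed.

Lemma cl_subset A B : A `<=` B -> cl R A `<=` cl R B.
Proof. by move=> AB; apply: closure_subset; exact: image_subset. Qed.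

Lemma clT : cl R [set: S] = setT.
Proof. exact: eps_dense. Qed.

Lemma cl_sub A (D : set X) : closed D -> (forall s, A s -> D (eps R s)) ->
  cl R A `<=` D.
Proof.
by move=> cD AD; rewrite /cl closureE; apply: smallest_sub => // _ [s As <-]; exact: AD.
Qed.

(** If [A] is the zero set of f, the transform of f vanishes on all of [cl A]. *)
Lemma cl_eps A s : Zsets A -> cl R A (eps R s) -> A s.
Proof.
move=> [f Lf <-] /= cs; rewrite -(gelfand_eps s Lf).
apply: (@cl_sub (f @^-1` [set 0]) [set mu | gelfand f mu = 0]) cs.
  by apply: closed_eqfun; [exact: gelfand_continuous|exact: cst_continuous].
by move=> s' fs' /=; rewrite gelfand_eps.
Qed.

(** By density, every neighbourhood of a point of [O] contains some [eps s] lying in [O], and then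
    [s] is in [A]. *)
Lemma open_sub_cl (O : set X) A : open O -> (@eps R S) @^-1` O `<=` A ->
  O `<=` (cl R A)°.
Proof.
move=> oO OA; rewrite -open_subsetE// => mu Omu B nB.
have : closure (range (@eps R S)) mu by rewrite eps_dense.
move=> /(_ (O `&` B)) []; first by apply: filterI => //; exact: open_nbhs_nbhs.
by move=> _ [[s _ <-] [Os Bs]]; exists (eps R s); split => //; exists s => //; exact: OA.
Qed.

Lemma interior_clI A B : Zsets A -> Zsets B ->
  (cl R A)° `&` (cl R B)° `<=` (cl R (A `&` B))°.
Proof.
move=> ZA ZB; apply: open_sub_cl; first by apply: openI; exact: open_interior.
by move=> s [/interior_subset cA /interior_subset cB]; split; exact: cl_eps.
Qed.

(** Inside a basic neighbourhood of radius d, the closed conditions of radius d / 2 cut out a zero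
    set. They persist on its closure, which therefore stays within radius d. *)
Lemma Zsets_regular mu (O : set X) : nbhs mu O ->
  exists A, [/\ Zsets A, (cl R A)° mu & cl R A `<=` O].
Proof.
move=> /gelfand_near_basis[fs [d [d0 Lfs sO]]].
have d20 : 0 < d / 2 by exact: divr_gt0.
pose A := [set s | forall f, f \in fs -> `|f s - gelfand f mu| <= d / 2].
exists A; split.
- rewrite /A; elim: fs Lfs {sO A} => [_|f fs IH Lfs].
    rewrite (_ : mkset _ = setT); first exact: ZsetsT.
    by apply/seteqP; split => // s _ f; rewrite in_nil.
  have -> : [set s | forall g, g \in f :: fs -> `|g s - gelfand g mu| <= d / 2] =
     [set s | `|f s - gelfand f mu| <= d / 2] `&`
     [set s | forall g, g \in fs -> `|g s - gelfand g mu| <= d / 2].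
    apply/seteqP; split => [s h|s [h1 h2] g].
      by split => [|g gfs]; apply: h; rewrite inE ?eqxx// gfs orbT.
    by rewrite inE => /predU1P[->//|]; exact: h2.
  apply: ZsetsI; first by apply/Zsets_disc/Lfs; rewrite inE eqxx.
  by apply: IH => g gfs; apply: Lfs; rewrite inE gfs orbT.
- have nW : nbhs mu (gelfand_near mu fs (d / 2)) by exact: gelfand_near_nbhs.
  apply: (@open_sub_cl (gelfand_near mu fs (d / 2))° A) nW; first exact: open_interior.
  move=> s /interior_subset/= h f ffs; have := h f ffs.
  by rewrite gelfand_eps; [exact: ltW|exact: Lfs].
- move=> nu cnu; apply: sO => f ffs.
  have : `|gelfand f nu - gelfand f mu| <= d / 2.
    apply: (@cl_sub A [set nu | `|gelfand f nu - gelfand f mu| <= d / 2]) cnu.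
      by apply: closed_disc; exact: gelfand_continuous.
    by move=> s As /=; rewrite gelfand_eps; [exact: As|exact: Lfs].
  by move/le_lt_trans; apply; rewrite ltr_pdivrMr// ltr_pMr// ltr1n.
Qed.

(** [D] is compact, so finitely many neighbourhoods from [Zsets_regular] cover it; their union
    works. *)
Lemma Zsets_normal (D O : set X) : closed D -> open O -> D `<=` O ->
  exists A, [/\ Zsets A, D `<=` (cl R A)° & cl R A `<=` O].
Proof.
move=> cD oO DO.
have cptD : compact D by apply: (subclosed_compact cD (@SLMC_compact R S)).
have /choice[A hA] mu : exists A, D mu ->
    [/\ Zsets A, (cl R A)° mu & cl R A `<=` O].
  have [Dmu|nD] := pselect (D mu); last by exists set0.
  have [|A hA] := @Zsets_regular mu O; last by exists A.
  by apply: open_nbhs_nbhs; split => //; exact: DO.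
have [|mu Dmu|D' [fD' sD' cD']] :=
    compact_finite_cover (f := fun mu => (cl R (A mu))°) (D := D) cptD.
- by move=> mu _; exact: open_interior.
- by exists mu => //; have [] := hA _ Dmu.
exists (\bigcup_(mu in D') A mu); split.
- by apply: Zsets_bigcup => // mu /sD'/hA[].
- move=> mu /cD'[nu D'nu]; apply: interiorS; apply: cl_subset.
  exact: bigcup_sup.
- apply: subset_trans (_ : \bigcup_(mu in D') cl R (A mu) `<=` O).
    apply: cl_sub; first by apply: closed_bigcup => // mu _; exact: cl_closed.
    by move=> s [mu D'mu As]; exists mu => //; apply: subset_closure; exists s.
  by move=> nu [mu /sD'/hA[_ _]]; apply.
Qed.

End ZeroSets.

(** * Convergence of z-ultrafilters and the closed sets [zbar F] *)

Section ZFilters.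
Context (R : realType) (S : semitopologicalSemigroupType).
Local Notation X := (SLMC R S).
Local Notation Zsets := (@Zsets R S).
Local Notation z_filter := (@z_filter R S).
Local Notation z_ultrafilter := (@z_ultrafilter R S).
Implicit Types (A B : set S) (F G p q : set (set S)) (mu nu : X).

Lemma z_ultrafilter_extend F : z_filter F ->
  exists p, z_ultrafilter p /\ F `<=` p.
Proof.
move=> zF; have [FZ FT F0 FI FS] := zF.
(* The family ranges over the sets [G] to be added to [F], so that the union of the empty chain also
   belongs to it. *)
have [|p [zp pmax]] := @Zorn_bigcup (set S) [set G | z_filter (F `|` G)].
  move=> K KP Ktot; have [->|/set0P[G0 KG0]] := eqVneq K set0.
    by rewrite /= bigcup_set0 setU0.
  have up A : (F `|` \bigcup_(G in K) G) A -> exists2 G, K G & (F `|` G) A.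
    by move=> [FA|[G KG GA]]; [exists G0 => //; left|exists G => //; right].
  have dn A G : K G -> (F `|` G) A -> (F `|` \bigcup_(G in K) G) A.
    by move=> KG [FA|GA]; [left|right; exists G].
  split.
  - by move=> A /up[G /KP[GZ _ _ _ _]]; exact: GZ.
  - by left.
  - by move=> /up[G /KP[_ _ G0' _ _]]; exact: G0'.
  - move=> A B /up[G KG GA] /up[H KH HB].
    have [GH|HG] := Ktot _ _ KG KH.
      apply: (dn _ H) => //; have [_ _ _ HI _] := KP _ KH; apply: HI => //.
      by case: GA => [|/GH]; [left|right].
    apply: (dn _ G) => //; have [_ _ _ GI _] := KP _ KG; apply: GI => //.
    by case: HB => [|/HG]; [left|right].
  - move=> A B /up[G KG GA] ZB AB; apply: (dn _ G) => //.
    by have [_ _ _ _ GS] := KP _ KG; exact: GS AB.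
exists (F `|` p); split; last by move=> A; left.
split => // q zq Fpq; apply: contrapT => nq.
have Fq : F `|` q = q by apply/setUidPr => A FA; apply: Fpq; left.
apply: (pmax q); last by rewrite /= Fq.
split; first by move=> A pA; apply: Fpq; right.
by move=> qp; apply: nq; apply/seteqP; split => // A /qp; right.
Qed.

Definition z_join F G : set (set S) :=
  [set C | Zsets C /\ exists A B, [/\ F A, G B & A `&` B `<=` C]].

Lemma z_join_filter F G : z_filter F -> z_filter G ->
  (forall A B, F A -> G B -> A `&` B !=set0) -> z_filter (z_join F G).
Proof.
move=> [FZ FT F0 FI FS] [GZ GT G0 GI GS] FG; split.
- by move=> C [].
- by split; [exact: ZsetsT|exists setT, setT].
- by move=> [_ [A [B [FA GB]]]]; have [s ABs] := FG _ _ FA GB; move=> /(_ s ABs).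
- move=> C C' [ZC [A [B [FA GB sC]]]] [ZC' [A' [B' [FA' GB' sC']]]].
  split; first exact: ZsetsI.
  exists (A `&` A'), (B `&` B'); split; [exact: FI|exact: GI|].
  by move=> s [[As A's] [Bs B's]]; split; [exact: sC|exact: sC'].
- move=> C C' [ZC [A [B [FA GB sC]]]] ZC' CC'; split => //.
  by exists A, B; split => //; exact: subset_trans sC CC'.
Qed.

Lemma z_joinl F G : z_filter F -> z_filter G -> F `<=` z_join F G.
Proof.
move=> [FZ _ _ _ _] [_ GT _ _ _] A FA; split; first exact: FZ.
by exists A, setT; split => // s [].
Qed.

Lemma z_joinr F G : z_filter F -> z_filter G -> G `<=` z_join F G.
Proof.
move=> [_ FT _ _ _] [GZ _ _ _ _] A GA; split; first exact: GZ.
by exists setT, A; split => // s [].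
Qed.

(** The join of [p] with the z-filter of all zero sets above [A] is a z-filter containing [p], hence
    equals [p]. *)
Lemma z_ultrafilter_meet p A : z_ultrafilter p -> Zsets A ->
  (forall B, p B -> B `&` A !=set0) -> p A.
Proof.
move=> [zp pmax] ZA pA; have [_ pT _ _ _] := zp.
pose G : set (set S) := [set B | Zsets B /\ A `<=` B].
have zG : z_filter G.
  split.
  - by move=> B [].
  - by split; [exact: ZsetsT|].
  - by move=> [_ A0]; have [s [_ /A0]] := pA _ pT.
  - move=> B C [ZB AB] [ZC AC]; split; first exact: ZsetsI.
    by move=> s As; split; [exact: AB|exact: AC].
  - by move=> B C [_ AB] ZC BC; split => //; exact: subset_trans BC.
rewrite -(pmax (z_join p G)).
- by apply: z_joinr => //; split.
- apply: z_join_filter => // B C pB [ZC AC].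
  by have [s [Bs /AC]] := pA _ pB; exists s.
- exact: z_joinl.
Qed.

Definition z_nbhs mu : set (set S) := [set A | Zsets A /\ (cl R A)° mu].

Lemma z_nbhs_filter mu : z_filter (z_nbhs mu).
Proof.
split.
- by move=> A [].
- by split; [exact: ZsetsT|rewrite clT interiorT].
- move=> [_ /interior_subset]; rewrite /cl image_set0 closure0; exact.
- move=> A B [ZA cA] [ZB cB]; split; first exact: ZsetsI.
  by apply: interior_clI.
- move=> A B [ZA cA] ZB AB; split => //.
  by apply: interiorS cA; exact: cl_subset.
Qed.

Lemma z_nbhs_meet mu A B : z_nbhs mu A -> cl R B mu -> A `&` B !=set0.
Proof.
move=> [ZA cA] cB; have [_ [[s Bs <-] /(cl_eps ZA) As]] := cB _ cA.
by exists s.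
Qed.

(** If [p] has limit [mu], each neighbourhood zero set meets every member of [p] and belongs to it
    by maximality. Conversely, [Zsets_regular] separates [mu] from any other point, and from [cl A]
    if that misses [mu]; the latter would give disjoint members of [p]. *)
Lemma zlim_ultrafilterP p mu : z_ultrafilter p ->
  zlim R p = [set mu] <-> z_nbhs mu `<=` p.
Proof.
move=> up; split => [pmu A nA|np].
  apply: z_ultrafilter_meet => //; first by case: nA.
  move=> B pB; rewrite setIC; apply: (z_nbhs_meet nA).
  have : zlim R p mu by rewrite pmu.
  exact.
have [[pZ _ p0 pI _] _] := up.
apply/seteqP; split => [nu pnu|_ -> A pA] /=.
  apply: contrapT => numu.
  have [|A [ZA cA sA]] := @Zsets_regular R S mu (~` [set nu]).
    apply: open_nbhs_nbhs; split; last by move=> /= munu; exact: numu.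
    rewrite openC; apply/accessible_closed_set1/hausdorff_accessible.
    exact: SLMC_hausdorff.
  by apply: (sA nu) => //; apply: pnu; apply: np; split.
apply: contrapT => nA.
have [|B [ZB cB sB]] := @Zsets_regular R S mu (~` cl R A).
  apply: open_nbhs_nbhs; split => //; rewrite openC; exact: cl_closed.
have [s [As Bs]] : A `&` B !=set0.
  apply/set0P/eqP => AB0; apply: p0; rewrite -AB0; apply: pI => //.
  by apply: np; split.
by apply: (sB (eps R s)); apply: subset_closure; exists s.
Qed.

(** If [mu] is in every [cl A], members of [F] meet those of [z_nbhs mu], and a z-ultrafilter above
    the join converges to [mu]. *)
Lemma zbarE F : z_filter F -> zbar R F = \bigcap_(A in F) cl R A.
Proof.
move=> zF; apply/seteqP; split => [mu [p [_ Fp pmu]] A /Fp|mu Fmu].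
  by have : zlim R p mu by [rewrite pmu]; exact.
have zn := z_nbhs_filter mu.
have [p [up jp]] : exists p, z_ultrafilter p /\ z_join F (z_nbhs mu) `<=` p.
  apply/z_ultrafilter_extend/z_join_filter => // A B FA nB.
  by rewrite setIC; apply: z_nbhs_meet nB _; exact: Fmu.
exists p; split => //; first by apply: subset_trans jp; exact: z_joinl.
by apply/zlim_ultrafilterP => //; apply: subset_trans jp; exact: z_joinr.
Qed.

Lemma zbar_closed F : z_filter F -> closed (zbar R F).
Proof. by move=> /zbarE ->; apply: closed_bigI => A _; exact: cl_closed. Qed.

Lemma zbar_nonempty F : z_filter F -> zbar R F !=set0.
Proof.
move=> zF; have [_ FT F0 FI _] := zF.
pose G : set_system X := filter_from F (cl R).
have GF : ProperFilter G.
  apply: filter_from_proper.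
    apply: filter_from_filter; first by exists setT.
    move=> A B FA FB; exists (A `&` B); first exact: FI.
    by move=> mu cAB; split; apply: cl_subset cAB => s [].
  move=> A FA; have [s As] : A !=set0 by apply/set0P/eqP => A0; rewrite A0 in FA.
  by exists (eps R s); apply: subset_closure; exists s.
have [|mu [_ cmu]] := @SLMC_compact R S G GF; first exact: filterT.
exists mu; rewrite zbarE// => A FA.
have : closure (cl R A) mu by move=> B nB; apply: cmu => //; exists A.
by rewrite -(closure_id _).1//; exact: cl_closed.
Qed.

Lemma z_nbhs_sub_zpoint mu : z_nbhs mu `<=` zpoint mu.
Proof. by move=> A nA q [uq /(zlim_ultrafilterP _ uq)]; apply. Qed.

(** A pure z-filter is the intersection of its [zpoint mu], and each of these contains
    [z_nbhs mu]. *)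
Lemma pure_z_filter_mem F A : pure_z_filter R F -> Zsets A ->
  zbar R F `<=` (cl R A)° -> F A.
Proof.
move=> [_ _ FE] ZA FA; rewrite FE => mu Fmu; apply: z_nbhs_sub_zpoint.
by split => //; exact: FA.
Qed.

(** A point outside [D] is excluded by a zero set whose closure is a neighbourhood of [D] missing
    the point; such a set lies in every [zpoint mu] with [mu] in [D]. *)
Lemma zbar_bigcap_zpoint (D : set X) : closed D ->
  z_filter (\bigcap_(mu in D) zpoint mu) ->
  zbar R (\bigcap_(mu in D) zpoint mu) = D.
Proof.
move=> cD zD; apply/seteqP; split => [nu|mu Dmu].
  rewrite zbarE// => Dnu; apply: contrapT => nD.
  have [|mu Dmu munu|A [ZA DA sA]] := @Zsets_normal R S D (~` [set nu]) cD.
  - rewrite openC; apply/accessible_closed_set1/hausdorff_accessible.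
    exact: SLMC_hausdorff.
  - by rewrite munu in Dmu.
  - apply: (sA nu) => //; apply: Dnu => mu Dmu; apply: z_nbhs_sub_zpoint.
    by split => //; exact: DA.
have [p [up np]] := z_ultrafilter_extend (z_nbhs_filter mu).
have pmu : zlim R p = [set mu] by exact/zlim_ultrafilterP.
by exists p; split => // A /(_ mu Dmu); apply.
Qed.

(** Translates the implications of (b) into topology. If [mu] were in both sets, some [H] would
    satisfy the premise with [mu] outside [cl H], whereas membership of [H] in [F] puts [mu] in
    [cl H]. *)
Lemma pure_zbar_disjointP F (O : set X) : pure_z_filter R F -> open O ->
  zbar R F `&` O = set0 <->
  (forall H, Zsets H -> ~` O `<=` (cl R H)° -> F H).
Proof.
move=> pF oO; have [zF _ _] := pF; split => [FO H ZH OH|h].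
  apply: pure_z_filter_mem => //; apply: subset_trans OH.
  by move=> mu Fmu Omu; rewrite -[False]/(set0 mu) -FO.
rewrite -subset0 => mu [Fmu Omu].
have [||nu nO nmu|H [ZH OH sH]] := @Zsets_normal R S (~` O) (~` [set mu]).
- by rewrite closedC.
- rewrite openC; apply/accessible_closed_set1/hausdorff_accessible.
  exact: SLMC_hausdorff.
- by apply: nO; rewrite nmu.
- apply: (sH mu) => //; move: Fmu; rewrite zbarE//; apply; exact: h.
Qed.

End ZFilters.

Lemma hausdorff_separation (T : topologicalType) : hausdorff_space T <->
  forall x y : T, x <> y ->
    exists U V, [/\ open U, open V, U x, V y & U `&` V = set0].
Proof.
rewrite open_hausdorff; split => h x y.
  move=> /eqP/h[[U V]/= [/set_mem Ux /set_mem Vy] [oU oV /eqP UV]].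
  by exists U, V; split.
move=> /eqP/h[U [V [oU oV Ux Vy UV]]].
by exists (U, V); split => //=; [exact/mem_set|exact/mem_set|exact/eqP].
Qed.

(** * The subbasis of the topology on [Gamma] *)

Section GammaTopology.
Context (R : realType) (S : semitopologicalSemigroupType).
Context (Gamma : set (set (set S))).
Local Notation X := (SLMC R S).
Local Notation G := (Gamma_space R (S := S) Gamma).

Lemma open_zstarC A : Zsets R A -> open (~` zstar R (Gamma := Gamma) A : set G).
Proof.
move=> ZA; exists [set ~` zstar R (Gamma := Gamma) A]; last by rewrite bigcup_set1.
move=> _ ->; exists [fset A]%fset; first by move=> B /[!inE] ->.
apply/seteqP; split => L /=; first by apply; rewrite /= inE.
by move=> h B; rewrite /= inE => /eqP ->.
Qed.

Lemma cvg_Gamma (F : set_system G) (L : G) : Filter F ->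
  (forall A, Zsets R A -> ~ zstar R (Gamma := Gamma) A L ->
     F (~` zstar R (Gamma := Gamma) A)) -> F --> L.
Proof.
move=> FF h W; rewrite nbhsE => -[_ [[B sB <-] [D BD DL] sW]].
apply: (filterS sW); apply: (@filterS _ F _ D); first by move=> K DK; exists D.
have [E sE DE] := sB _ BD; rewrite -DE; apply: filter_bigI => A EA.
have ZA : Zsets R A by have := sE _ EA; rewrite inE.
by apply: h => //; move: DL; rewrite -DE; apply.
Qed.

End GammaTopology.

(** * Conditions (a) and (b) in topological form *)

Section ZFilterQuotient.
Context (R : realType) (S : semitopologicalSemigroupType).
Context (Gamma : set (set (set S))).
Hypothesis hGamma : Gamma `<=` [set F | pure_z_filter R F].
Local Notation X := (SLMC R S).

Definition finite_choice_cover : Prop :=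
  forall f : set (set S) -> set S, topological_choice R Gamma f ->
  exists2 F : set (set (set S)), finite_set F /\ F `<=` Gamma &
    [set: X] = \bigcup_(L in F) (cl R (f L))°.

(** Condition (b) with its implications replaced by disjointness; [zbar_separatedE] relates the two
    forms. *)
Definition zbar_separated : Prop :=
  forall L K, Gamma L -> Gamma K -> L <> K ->
  exists A B, [/\ zint R L A, zint R K B &
    forall C, Gamma C -> zbar R C `&` (cl R A)° = set0 \/
                         zbar R C `&` (cl R B)° = set0].

Let zG L : Gamma L -> z_filter R L. Proof. by move=> /hGamma[]. Qed.

Lemma zbar_separatedE : zbar_separated <->
  forall L K, Gamma L -> Gamma K -> L <> K ->
  exists A B, [/\ zint R L A, zint R K B &
    forall C, Gamma C -> forall H T, Zsets R H -> Zsets R T ->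
      (~` (cl R A)° `<=` (cl R H)° -> C H) \/
      (~` (cl R B)° `<=` (cl R T)° -> C T)].
Proof.
have sepE A B C : Gamma C ->
    (zbar R C `&` (cl R A)° = set0 \/ zbar R C `&` (cl R B)° = set0) <->
    forall H T, Zsets R H -> Zsets R T ->
      (~` (cl R A)° `<=` (cl R H)° -> C H) \/
      (~` (cl R B)° `<=` (cl R T)° -> C T).
  move=> /hGamma pC.
  have disj (O : set X) := pure_zbar_disjointP (O := O) pC.
  split=> [[/disj|/disj] h H T ZH ZT|h].
  - by left; apply: h => //; exact: open_interior.
  - by right; apply: h => //; exact: open_interior.
  (* [H] and [T] vary independently: a single [H] violating the first implication forces the second
     one for every [T]. *)
  have [h1|] := pselect (forall H, Zsets R H -> ~` (cl R A)° `<=` (cl R H)° -> C H).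
    by left; apply/disj => //; exact: open_interior.
  move=> /existsNP[H /not_implyP[ZH nH]]; right; apply/disj; first exact: open_interior.
  by move=> T ZT; have [/nH|] := h H T ZH ZT.
split=> h L K GL GK LK; have [A [B [LA KB hC]]] := h L K GL GK LK;
  by exists A, B; split => // C GC; apply/sepE => //; exact: hC.
Qed.

(** * From a Hausdorff quotient to (a) and (b) *)

Section QuotientSide.
Context (E : equiv_rel X).
Local Notation Q := (quotient_topology {eq_quot E}%qT).
Hypothesis hausQ : hausdorff_space Q.
Hypothesis GammaE :
  Gamma = [set \bigcap_(y in [set y | E x y]) zpoint y | x in [set: X]].

Let cls (x : X) : set X := [set y | E x y].
Let pi (x : X) : Q := (\pi_Q x)%qT.

Let clsP x y : cls x y <-> pi x = pi y.
Proof. by have h := @eqquotP _ E {eq_quot E}%qT x y; split => /h. Qed.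

Let cls_closed x : closed (cls x).
Proof.
rewrite (_ : cls x = pi @^-1` [set pi x]).
  apply: closed_comp; first by move=> y _; exact: pi_continuous.
  exact/accessible_closed_set1/hausdorff_accessible.
by apply/seteqP; split => y /=; rewrite clsP.
Qed.

Let zbar_cls L : Gamma L -> exists x, L = \bigcap_(y in cls x) zpoint y /\
  zbar R L = cls x.
Proof.
move=> /[dup] /zG zL; rewrite {1}GammaE => -[x _ xL]; exists x; split => //.
by rewrite -xL; apply: zbar_bigcap_zpoint; [exact: cls_closed|rewrite xL].
Qed.

Lemma quotient_finite_choice_cover : finite_choice_cover.
Proof.
move=> f hf.
have [|mu _|D [fD sD cD]] := compact_finite_cover (f := fun L => (cl R (f L))°)
    (D := Gamma) (@SLMC_compact R S).
- by move=> L _; exact: open_interior.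
- pose L := \bigcap_(y in cls mu) zpoint y.
  have GL : Gamma L by rewrite GammaE; exists mu.
  exists L => //; apply: (hf _ GL).2.
  by rewrite zbar_bigcap_zpoint; [exact/clsP|exact: cls_closed|exact: zG].
- by exists D => //; apply/seteqP; split.
Qed.

(** Disjoint open sets of the quotient pull back to saturated open sets, inside which [Zsets_normal]
    finds [A] and [B]. A class meeting the first preimage lies in it, so it misses the second. *)
Lemma quotient_zbar_separated : zbar_separated.
Proof.
move=> L K GL GK LK.
have [x [xL zL]] := zbar_cls GL; have [y [yK zK]] := zbar_cls GK.
have xy : pi x <> pi y.
  move=> pxy; apply: LK; rewrite xL yK; congr (\bigcap_(_ in _) _).
  by apply/seteqP; split => z /=; rewrite !clsP pxy.
have [U [V [oU oV Ux Vy UV0]]] := (hausdorff_separation Q).1 hausQ _ _ xy.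
have opi (W : set Q) : open W -> open (pi @^-1` W).
  by move=> oW; move/continuousP : (@pi_continuous _ {eq_quot E}%qT); exact.
have fromW M w (W : set Q) : Gamma M -> zbar R M = cls w -> open W -> W (pi w) ->
    exists A, zint R M A /\ cl R A `<=` pi @^-1` W.
  move=> GM Mw oW Ww.
  have [|A [ZA wA AW]] := Zsets_normal (cls_closed (x := w)) (opi _ oW).
    by move=> v /clsP wv; rewrite /= -wv.
  exists A; split => //; split; last by rewrite Mw.
  by apply: (pure_z_filter_mem (hGamma GM)) => //; rewrite Mw.
have [A [LA AU]] := fromW _ _ _ GL zL oU Ux.
have [B [KB BV]] := fromW _ _ _ GK zK oV Vy.
exists A, B; split => // C GC; have [z [_ zC]] := zbar_cls GC.
rewrite zC; have [Uz|nU] := pselect (U (pi z)); [right|left].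
  rewrite -subset0 => w [/clsP zw /interior_subset/BV /= Vw].
  by have : set0 (pi z) by [rewrite -UV0; split => //; rewrite zw].
by rewrite -subset0 => w [/clsP zw /interior_subset/AU /=]; rewrite -zw.
Qed.

End QuotientSide.

(** * From (a) and (b) to a Hausdorff quotient homeomorphic to [Gamma] *)

Section ChoiceSide.
Hypothesis ha : finite_choice_cover.
Hypothesis hb : zbar_separated.

Lemma zbar_disjoint L K mu : Gamma L -> Gamma K ->
  zbar R L mu -> zbar R K mu -> L = K.
Proof.
move=> GL GK Lmu Kmu; apply: contrapT => LK.
have [A [B [[_ LA] [_ KB] hC]]] := hb GL GK LK.
(* With [C] := [L], the common point [mu] lies in [zbar L] and in both neighbourhoods. *)
have [h|h] := hC _ GL.
  by rewrite -[False]/(set0 mu) -h; split => //; exact: LA.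
by rewrite -[False]/(set0 mu) -h; split => //; exact: KB.
Qed.

Lemma zbar_cover mu : exists L, Gamma L /\ zbar R L mu.
Proof.
apply: contrapT => /forallNP nL.
(* Every value of this choice function has a closure missing [mu], so no finite subfamily covers
   [mu]. *)
have /choice[f hf] L : exists A, Gamma L ->
    [/\ L A, zbar R L `<=` (cl R A)° & ~ cl R A mu].
  have [GL|nG] := pselect (Gamma L); last by exists set0.
  have zL := zG GL.
  have [||nu Lnu /= numu|A [ZA LA sA]] :=
      @Zsets_normal R S (zbar R L) (~` [set mu]).
  - exact: zbar_closed.
  - rewrite openC; apply/accessible_closed_set1/hausdorff_accessible.
    exact: SLMC_hausdorff.
  - by apply: (nL L); rewrite -numu.
  - exists A => _; split => //; last by move=> /sA; exact.
    exact: pure_z_filter_mem (hGamma GL) ZA LA.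
have [L GL|F [_ sF] XF] := ha (f := f).
  by have [fL zf _] := hf _ GL; split => //; exists L.
have : setT mu by [].
rewrite XF => -[L /sF GL /interior_subset].
by have [_ _] := hf _ GL.
Qed.

(** By [zbar_disjoint], the chosen member of [Gamma] is the only one whose [zbar] contains the
    point; it labels the class of that point. *)
Let lam : X -> set (set S) := projT1 (choice zbar_cover).

Let lamP mu : Gamma (lam mu) /\ zbar R (lam mu) mu.
Proof. exact: (projT2 (choice zbar_cover)). Qed.

Let lamE mu L : Gamma L -> zbar R L mu -> lam mu = L.
Proof. by move=> GL Lmu; have [? ?] := lamP mu; exact: (zbar_disjoint (mu := mu)). Qed.

(* Upper semicontinuity of the decomposition of X into the sets zbar L: given
   L, apply the covering property to the choice function that takes a small
   neighbourhood of zbar L at L and, at each other K, the member B of K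
   separating K from L. *)
Lemma zbar_usc (O : set X) : open O -> open [set mu | zbar R (lam mu) `<=` O].
Proof.
move=> oO; rewrite openE => mu /= LO.
have [GL Lmu] := lamP mu; set L := lam mu in LO GL Lmu *.
have [A0 [ZA0 LA0 A0O]] := Zsets_normal (zbar_closed (zG GL)) oO LO.
have LmA0 : L A0 by exact: pure_z_filter_mem (hGamma GL) ZA0 LA0.
have /choice[g hg] K : exists AB : set S * set S, Gamma K -> L <> K ->
    [/\ zint R L AB.1, zint R K AB.2 &
    forall C, Gamma C -> zbar R C `&` (cl R AB.1)° = set0 \/
                         zbar R C `&` (cl R AB.2)° = set0].
  have [[GK LK]|nK] := pselect (Gamma K /\ L <> K).
    by have [A [B h]] := hb GL GK LK; exists (A, B).
  by exists (set0, set0) => GK LK; case: nK.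
pose f K := if `[< L = K >] then A0 else (g K).2.
have [K GK|F [fF sF] XF] := ha (f := f).
  rewrite /f; case: asboolP => LK; first by rewrite -LK; split => //; exists L.
  by have [_ [KB KBc] _] := hg _ GK LK; split => //; exists K.
pose F' := F `&` [set K | L <> K].
have oV : open (\bigcap_(K in F') (cl R (g K).1)°).
  rewrite -closedC setC_bigcap; apply: closed_bigcup.
    by apply: sub_finite_set fF => K [].
  by move=> K _; rewrite closedC; exact: open_interior.
have nV : nbhs mu (\bigcap_(K in F') (cl R (g K).1)°).
  apply: open_nbhs_nbhs; split => // K [FK LK].
  by have [[_ LA] _ _] := hg _ (sF _ FK) LK; exact: LA.
(* At [nu], the set [zbar (lam nu)] meets the interior of each [cl (g K).1], hence misses that of
   each [cl (g K).2]. Of the finite cover only the interior of [cl A0] can contain [z]. *)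
apply: filterS nV => nu Vnu z Cz; have [GC Cnu] := lamP nu.
have : setT z by [].
rewrite XF => -[K FK]; rewrite /f; case: asboolP => [_|LK].
  by move=> /interior_subset/A0O.
have [_ _ hC] := hg _ (sF _ FK) LK; have [h|h] := hC _ GC => Bz.
  by have : set0 nu by [rewrite -h; split => //; exact: Vnu].
by have : set0 z by [rewrite -h].
Qed.

Let lam_rel : rel X := fun x y => `[< lam x = lam y >].

Let lam_refl : reflexive lam_rel. Proof. by move=> x; exact/asboolP. Qed.

Let lam_sym : symmetric lam_rel.
Proof. by move=> x y; apply/asboolP/asboolP. Qed.

Let lam_trans : transitive lam_rel.
Proof. by move=> y x z /asboolP xy /asboolP yz; apply/asboolP; rewrite xy. Qed.

Let E : equiv_rel X := EquivRel lam_rel lam_refl lam_sym lam_trans.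
Local Notation Q := (quotient_topology {eq_quot E}%qT).
Let pi (x : X) : Q := (\pi_Q x)%qT.

Let piP x y : pi x = pi y <-> lam x = lam y.
Proof.
have h := @eqquotP _ E {eq_quot E}%qT x y.
by split => [/h/asboolP|xy]; [|apply/h/asboolP].
Qed.

Let lam_repr x : lam (repr (pi x)) = lam x.
Proof. by apply/piP; exact: reprK. Qed.

Let usc_quotient_open (O : set X) : open O ->
  open [set q : Q | zbar R (lam (repr q)) `<=` O].
Proof.
move=> oO; have := zbar_usc oO.
rewrite (_ : mkset _ = pi @^-1` [set q : Q | zbar R (lam (repr q)) `<=` O]) //.
by apply/seteqP; split => x /=; rewrite lam_repr.
Qed.

(** The classes contained in each of the two neighbourhoods from (b) form open sets of the quotient.
    No class lies in both, since it is nonempty and would meet both neighbourhoods. *)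
Let quotient_hausdorff : hausdorff_space Q.
Proof.
apply/hausdorff_separation => p q pq.
have [GL Lp] := lamP (repr p); have [GK Kq] := lamP (repr q).
have LK : lam (repr p) <> lam (repr q).
  by move=> /piP h; apply: pq; rewrite -[p]reprK -[q]reprK; exact: h.
have [A [B [[_ LA] [_ KB] hC]]] := hb GL GK LK.
exists [set r | zbar R (lam (repr r)) `<=` (cl R A)°],
       [set r | zbar R (lam (repr r)) `<=` (cl R B)°]; split => //.
- by apply: usc_quotient_open; exact: open_interior.
- by apply: usc_quotient_open; exact: open_interior.
rewrite -subset0 => r [/= rA rB]; have [GC Cr] := lamP (repr r).
have [h|h] := hC _ GC.
  by have : set0 (repr r) by rewrite -h; split => //; exact: rA.
by have : set0 (repr r) by rewrite -h; split => //; exact: rB.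
Qed.

(** The class of [x] is [zbar (lam x)], from which purity recovers [lam x]. *)
Let Gamma_classes :
  Gamma = [set \bigcap_(y in [set y | E x y]) zpoint y | x in [set: X]].
Proof.
have clsE x : [set y | E x y] = zbar R (lam x).
  apply/seteqP; split => y /=.
    by move=> /asboolP ->; have [] := lamP y.
  by move=> xy; apply/asboolP; rewrite (lamE (lamP x).1 xy).
have capE x : \bigcap_(y in [set y | E x y]) zpoint y = lam x.
  by rewrite clsE; have [_ _ <-] := hGamma (lamP x).1.
apply/seteqP; split => [L GL|_ [x _ <-]]; last by rewrite capE; have [] := lamP x.
have [x Lx] := zbar_nonempty (zG GL).
by exists x => //; rewrite capE; exact: lamE.
Qed.

Let pt (L : Gamma_space R Gamma) : X :=
  projT1 (cid (zbar_nonempty (zG (set_mem (valP L))))).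

Let ptP L : zbar R (set_val L) (pt L).
Proof. exact: (projT2 (cid (zbar_nonempty (zG (set_mem (valP L)))))). Qed.

Let lam_pt L : lam (pt L) = set_val L.
Proof. by apply: lamE; [exact: set_mem (valP L)|exact: ptP]. Qed.

Let to_quotient (L : Gamma_space R Gamma) : Q := pi (pt L).

Let of_quotient (q : Q) : Gamma_space R Gamma :=
  SigSub (mem_set (lamP (repr q)).1).

Let to_quotientK : cancel to_quotient of_quotient.
Proof. by move=> L; apply: val_inj; rewrite /= lam_repr lam_pt. Qed.

Let of_quotientK : cancel of_quotient to_quotient.
Proof.
by move=> q; rewrite -[RHS]reprK; apply/piP; rewrite lam_pt set_valE.
Qed.

(** On the subbasis, the classes missing [cl A] form an open set by upper semicontinuity. *)
Let of_quotient_continuous : continuous of_quotient.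
Proof.
move=> q; apply: (cvg_Gamma (fmap_filter _ (nbhs_filter q))) => A ZA /= nA.
have : nbhs q [set r : Q | zbar R (lam (repr r)) `<=` ~` cl R A].
  apply: open_nbhs_nbhs; split.
    by apply: usc_quotient_open; rewrite openC; exact: cl_closed.
  by move=> z qz Az; apply: nA; exists z.
by apply: filterS => r rA [z [rz Az]]; exact: rA Az.
Qed.

Let to_quotient_continuous : continuous to_quotient.
Proof.
apply/continuousP => U oU; rewrite openE => L /= UL.
have oV : open (pi @^-1` U).
  by move/continuousP : (@pi_continuous _ {eq_quot E}%qT); exact.
have zV (K : Gamma_space R Gamma) z : zbar R (set_val K) z -> pi z = to_quotient K.
  by move=> Kz; apply/piP; rewrite lam_pt; apply: lamE => //; exact: set_mem (valP K).
have zL := zG (set_mem (valP L)).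
(* [A] is taken around the complement of the preimage of [U] and away from [zbar L]: any [K] whose
   [zbar] misses [cl A] is then sent into [U]. *)
have [|||A [ZA VA AL]] := @Zsets_normal R S (~` (pi @^-1` U)) (~` zbar R (set_val L)).
- by rewrite closedC.
- by rewrite openC; exact: zbar_closed.
- by move=> z nUz Lz; apply: nUz; rewrite /= (zV _ _ Lz).
have oW := @open_zstarC _ _ Gamma _ ZA.
have : nbhs L (~` zstar R (Gamma := Gamma) A : set (Gamma_space R Gamma)).
  by apply: open_nbhs_nbhs; split => // -[z [Lz /AL]]; exact.
apply: filterS => K nKA /=; apply: contrapT => nU; apply: nKA.
exists (pt K); split; first exact: ptP.
by apply: interior_subset; exact: VA.
Qed.

Lemma choice_quotient : exists E : equiv_rel X,
  [/\ hausdorff_space (quotient_topology {eq_quot E}%qT),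
      Gamma = [set \bigcap_(y in [set y | E x y]) zpoint y | x in [set: X]] &
      homeomorphic (Gamma_space R Gamma) (quotient_topology {eq_quot E}%qT)].
Proof. by exists E; split => //; exists to_quotient, of_quotient; split. Qed.

End ChoiceSide.

End ZFilterQuotient.

Theorem theorem3p9 (R : realType) (S : semitopologicalSemigroupType)
    (hS : hausdorff_space S) (Gamma : set (set (set S)))
    (hGamma : Gamma `<=` [set F | pure_z_filter R F]) :
  (exists E : equiv_rel (SLMC R S),
     [/\ hausdorff_space (quotient_topology {eq_quot E}%qT),
         Gamma = [set \bigcap_(y in [set y | E x y]) zpoint y
                 | x in [set: SLMC R S]] &
         homeomorphic (Gamma_space R Gamma)
                      (quotient_topology {eq_quot E}%qT)])
  <->
  ((forall f : set (set S) -> set S, topological_choice R Gamma f ->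
      exists2 F : set (set (set S)), finite_set F /\ F `<=` Gamma &
        [set: SLMC R S] = \bigcup_(L in F) (cl R (f L))°) /\
   (forall L K, Gamma L -> Gamma K -> L <> K ->
      exists A B, [/\ zint R L A, zint R K B &
        forall C, Gamma C -> forall H T, Zsets R H -> Zsets R T ->
          (~` (cl R A)° `<=` (cl R H)° -> C H) \/
          (~` (cl R B)° `<=` (cl R T)° -> C T)])).
Proof.
split=> [[E [hausQ GammaE _]]|[ha hb]].
  split; first exact: quotient_finite_choice_cover hGamma E hausQ GammaE.
  exact/(zbar_separatedE hGamma)/(quotient_zbar_separated hGamma hausQ GammaE).
by apply: choice_quotient => //; exact/(zbar_separatedE hGamma).
Qed.
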